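(* Let $H$ be a simple hypergraph with $e$-index $k$ and let $P_{\mathbf{U}(H)}(x)=x^{k}+c_1x^{k-1}+\dots+c_{k-1}x+c_{k}$ be the characteristic polynomial of its unified matrix $\mathbf{U}(H)$. (i) The odd exact girth $oegr(H)$ is equal to the index of the first non-zero coefficient in the sequence $c_1,c_3,c_5,\dots$ (both being understood as $\infty$ when they do not exist). Moreover, when $d=oegr(H)$ is finite, the number of exact cycles of length $d$ in $H$ is $-\frac12 c_d$. (ii) For $i=1,2,\dots,k$ let $$\gamma_i=\begin{cases} c_i, & i \text{ odd};\\ c_i-(-1)^{i/2}\omega_i, & i\text{ even},\end{cases}$$ where $\omega_i$ is the number of elementary $i$-subhypergraphs of $H$ of the form $(H',\emptyset,\mathcal{E}(H'))_i$ (each $\mathcal{E}(H')$ being counted once). Then the exact girth $egr(H)$ is equal to the index of the first non-zero term in the sequence $\gamma_1,\gamma_2,\gamma_3,\dots$ (both being understood as $\infty$ when they do not exist). Moreover, when $t=egr(H)$ is finite, the number of exact cycles of length $t$ in $H$ is $-\frac12\gamma_t$.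
   Context: A hypergraph $H$ consists of a finite non-empty vertex set $V(H)$ and a multiset $E(H)$ of non-empty subsets of $V(H)$, called edges. It is simple if it has no loops (edges of cardinality one) and no multiple edges. A subhypergraph $H'$ of $H$ is a hypergraph with $V(H')\subseteq V(H)$, $E(H')\subseteq E(H)$. A 2-partition of a set $e$ is an unordered pair $\{S,S'\}$ of non-empty disjoint sets with $S\cup S'=e$; $S$ and $S'$ are called parts of $e$. $I(H)$ is the set of all parts of all edges of $H$ together with all singleton subsets of $V(H)$, and $k=|I(H)|$ is the $e$-index of $H$. For simple $H$, the unified matrix $\mathbf{U}(H)$ is the $k\times k$ matrix indexed by $I(H)$ whose $(S,S')$ entry is $1$ if $\{S,S'\}$ is a 2-partition of an edge of $H$, and $0$ otherwise. The characteristic polynomial of a square matrix $M$ is $P_M(x)=\det(xI-M)$. An exact walk in $H$ is a sequence $S_0,e_1,S_1,\dots,e_n,S_n$ such that $\{S_{i-1},S_i\}$ is a 2-partition of the edge $e_i$ of $H$ for each $i$; its length is $n$ and its cover is the set of its parts. An exact cycle $C$ is an exact walk with at least three distinct edges, with $S_0=S_n$ and $S_0,\dots,S_{n-1}$ pairwise distinct; $l(C)$ denotes its length. Exact cycles that differ only by starting part or direction of traversal are counted as the same. The exact girth $egr(H)$ is the minimum length of an exact cycle in $H$, and the odd exact girth $oegr(H)$ is the minimum length of an exact cycle of odd length in $H$. An elementary $q$-subhypergraph of $H$ is a triplet $(H',\mathcal{C}(H'),\mathcal{E}(H'))_q$ such that: (i) $H'$ is a subhypergraph of $H$; (ii) $\mathcal{C}(H')$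 is a (possibly empty) set of exact cycles in $H'$ with pairwise disjoint covers, and $\mathcal{E}(H')$ is a (possibly empty) set of 2-partitions of some edges of $H'$, with $\sum_{C\in\mathcal{C}(H')}l(C)+2|\mathcal{E}(H')|=q$; (iii) letting $\mathcal{C}^*(H')$ be the union of the covers of the exact cycles in $\mathcal{C}(H')$, each $S\in\mathcal{C}^*(H')\cup\bigcup_{T\in\mathcal{E}(H')}T$ belongs either to $\mathcal{C}^*(H')$ or to exactly one member of $\mathcal{E}(H')$, but not both. Elementary $q$-subhypergraphs with the same pair $(\mathcal{C}(H'),\mathcal{E}(H'))$ are regarded as the same. In particular, $\omega_i$ is the number of sets of $i/2$ 2-partitions of edges of $H$, no two of which share a part. *)

(* Defs.v *)
From mathcomp Require Import all_boot all_order all_algebra.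
From mathcomp Require Import finmap multiset.
From mathcomp Require Import boolp.

Set Implicit Arguments.
Unset Strict Implicit.
Unset Printing Implicit Defensive.

Import GRing.Theory Num.Theory.

Section Hypergraph.
Variable T : finType.
Implicit Types (S e : {set T}) (P : {set {set T}}).

(* T is only an ambient type: the vertex set is [verts], so that a
   subhypergraph may have fewer vertices. *)
Record hypergraph := Hypergraph {
  verts : {set T};
  edges : {mset {set T}}%mset;
  verts_neq0 : verts != set0;
  edges_neq0 : forall e, e \in edges -> e != set0;
  edges_sub : forall e, e \in edges -> e \subset verts
}.
Implicit Types H : hypergraph.

Definition simple_hypergraph H : Prop :=
  (forall e, e \in edges H -> #|e| != 1) /\ (forall e, edges H e <= 1).

Definition subhypergraph (H' H : hypergraph) : Prop :=
  verts H' \subset verts H /\ (edges H' `<=` edges H)%mset.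

Definition two_partition P e : bool := partition P e && (#|P| == 2).

Definition edge_two_partition H P : bool :=
  [exists e : {set T}, (e \in edges H) && two_partition P e].

Definition parts H : {set {set T}} :=
  [set S | [exists P : {set {set T}}, edge_two_partition H P && (S \in P)]]
  :|: [set [set v] | v in verts H].

Definition e_index H : nat := #|parts H|.

Definition unified_mx (R : nzRingType) H : 'M[R]_(e_index H) :=
  \matrix_(i, j) ((edge_two_partition H [set enum_val i; enum_val j])%:R)%R.

(* The coefficient c_i of x^(k-i) in det(xI - U(H)), meant for i <= k. *)
Definition charcoef (R : nzRingType) H (i : nat) : R :=
  ((char_poly (unified_mx R H))`_(e_index H - i))%R.

(* (S_0, [:: (e_1, S_1); ...; (e_n, S_n)]) encodes S_0, e_1, S_1, ..., e_n, S_n. *)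
Definition walk : Type := ({set T} * seq ({set T} * {set T}))%type.
Implicit Types c : walk.

Definition walk_length c : nat := size c.2.
Definition walk_edges c : seq {set T} := unzip1 c.2.
Definition walk_parts c : seq {set T} := c.1 :: unzip2 c.2.
Definition walk_last c : {set T} := last c.1 (unzip2 c.2).
Definition walk_belast c : seq {set T} := belast c.1 (unzip2 c.2).
Definition walk_cover c : {set {set T}} := [set S in walk_parts c].

Fixpoint exact_walk_from H S (w : seq ({set T} * {set T})) : bool :=
  if w is (e, S') :: w' then
    [&& e \in edges H, two_partition [set S; S'] e & exact_walk_from H S' w']
  else true.

Definition exact_walk H c : bool := exact_walk_from H c.1 c.2.

Definition exact_cycle H c : bool :=
  [&& exact_walk H c, 3 <= size (undup (walk_edges c)),
      c.1 == walk_last c & uniq (walk_belast c)].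

(* The closed walk c, started at S_i instead of S_0. *)
Definition walk_shift (i : nat) c : walk :=
  (last c.1 (unzip2 (take i c.2)), rot i c.2).

(* S_n, e_n, S_(n-1), ..., e_1, S_0. *)
Definition walk_rev c : walk :=
  (walk_last c, zip (rev (walk_edges c)) (rev (walk_belast c))).

Definition same_cycle c c' : bool :=
  [exists i : 'I_(walk_length c),
     (c' == walk_shift i c) || (c' == walk_shift i (walk_rev c))].

Local Notation nwalk n := ({set T} * n.-tuple ({set T} * {set T}))%type.

Definition walk_of n (c : nwalk n) : walk := (c.1, val c.2).

Definition exact_cycles H n : {set nwalk n} :=
  [set c : nwalk n | exact_cycle H (walk_of c)].

(* same_cycle is an equivalence relation on exact cycles. *)
Definition num_exact_cycles H n : nat :=
  #|equivalence_partition
      (fun c c' : nwalk n =>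
         same_cycle (walk_of c) (walk_of c'))
      (exact_cycles H n)|.

(* (H', CC, EE)_q.  Each exact cycle in CC is given by one of its traversals;
   as the covers are non-empty and pairwise disjoint, no exact cycle can be
   listed twice. *)
Definition elementary H (q : nat) (H' : hypergraph)
    (CC : {fset walk}%fset) (EE : {set {set {set T}}}) : Prop :=
  let Cstar := \bigcup_(c <- enum_fset CC) walk_cover c in
  [/\ subhypergraph H' H,
      (forall c, c \in CC -> exact_cycle H' c)
      /\ (forall c c', c \in CC -> c' \in CC -> c != c' ->
            [disjoint walk_cover c & walk_cover c']),
      forall P, P \in EE -> edge_two_partition H' P,
      \sum_(c <- enum_fset CC) walk_length c + 2 * #|EE| = q
    & forall S, S \in Cstar :|: cover EE ->
        if S \in Cstar then S \notin cover EE
        else #|[set P in EE | S \in P]| == 1].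

Definition omega H (i : nat) : nat :=
  #|[set EE : {set {set {set T}}} |
      `[< exists H', elementary H i H' fset0 EE >]]|.

Definition gamma (R : nzRingType) H (i : nat) : R :=
  if odd i then charcoef R H i
  else (charcoef R H i - (-1) ^+ i./2 * (omega H i)%:R)%R.

End Hypergraph.

(* The least n satisfying P; None stands for infinity. *)
Definition least (P : pred nat) : option nat :=
  if pselect (exists n, P n) is left exP then Some (ex_minn exP) else None.

Definition egr (T : finType) (H : hypergraph T) : option nat :=
  least (fun n => exact_cycles H n != set0).

Definition oegr (T : finType) (H : hypergraph T) : option nat :=
  least (fun n => odd n && (exact_cycles H n != set0)).

(* Main.v *)
Require Import Defs.
From mathcomp Require Import all_boot all_order all_algebra all_fingroup.
From mathcomp Require Import finmap multiset boolp.
Import GRing.Theory Num.Theory.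

Set Implicit Arguments.
Unset Strict Implicit.
Unset Printing Implicit Defensive.

(** The unified matrix is the adjacency matrix of a simple graph: its vertices
    are the parts of [H], and [S], [S'] are adjacent ([adj]) when they form a
    2-partition of an edge, which then has to be [S :|: S'].  Exact cycles are
    the cycles of length at least three of this graph, since the edges along
    such a cycle automatically take at least three values ([three_edges]).  The
    theorem is thus an instance of Sachs's description of the characteristic
    polynomial of a graph.

    In the Leibniz expansion of [det (xI - U)] a permutation contributes only
    if it sends each point that it moves to a neighbour; a contributing permutation
    moving [i] points yields a monomial of degree [k - i], and its sign together
    with the sign of its [i] off-diagonal entries is [(-1)] to the number of its
    nontrivial orbits ([coef_char_poly_adj]).  So [c_i] is a signed count of
    permutations moving exactly [i] points along the graph.  An orbit with three
    or more points is an exact cycle.  Hence, as long as no exact cycle is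
    shorter than [i], such a permutation is either an involution, that is a
    matching with [i / 2] edges, or a single [i]-cycle ([sum_follows]).  The
    involutions add up to [(-1)^(i/2) omega_i], which [gamma_i] removes, and
    each [i]-cycle counts for [-1].  If only odd cycles are known to be absent
    and [i] is odd, one orbit is odd and nontrivial, and the same conclusion
    holds without involutions ([sum_follows_odd]).

    Finally every exact cycle is traversed by exactly two cyclic permutations,
    inverse to each other, so the number of [i]-cycles is twice the number of
    exact cycles of length [i] ([card_cyclic_perms]).  The first nonvanishing
    coefficient is therefore [-2] times the number of shortest cycles. *)

(** * Determinants indexed by a subset *)

(** Permutations of the index set ['I_n] of a matrix are moved to the type that
    the indices enumerate, where orbits can be compared with walks. *)
Definition transport_fun (U V : finType) (f : U -> V) (s : {perm U}) (x : V) :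
    V :=
  if [pick u | f u == x] is Some u then f (s u) else x.

Lemma transport_fun_image (U V : finType) (f : U -> V) (f_inj : injective f)
  (s : {perm U}) (u : U) : transport_fun f s (f u) = f (s u).
Proof.
rewrite /transport_fun; case: pickP => [v /eqP /f_inj -> // | /(_ u)].
by rewrite eqxx.
Qed.

Lemma transport_fun_out (U V : finType) (f : U -> V) (s : {perm U}) (x : V) :
  x \notin codom f -> transport_fun f s x = x.
Proof.
rewrite /transport_fun; case: pickP => // u /eqP <-.
by rewrite codom_f.
Qed.

Lemma transport_fun_inj (U V : finType) (f : U -> V) (f_inj : injective f)
  (s : {perm U}) : injective (transport_fun f s).
Proof.
apply: (can_inj (g := transport_fun f s^-1)) => x.
have [/codomP[u ->] | xNf] := boolP (x \in codom f).
  by rewrite !transport_fun_image // permK.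
by rewrite !transport_fun_out.
Qed.

Definition transport_perm (U V : finType) (f : U -> V) (f_inj : injective f)
  (s : {perm U}) : {perm V} := perm (transport_fun_inj f_inj (s := s)).

Lemma transport_permE (U V : finType) (f : U -> V) (f_inj : injective f)
  (s : {perm U}) (u : U) : transport_perm f_inj s (f u) = f (s u).
Proof. by rewrite permE transport_fun_image. Qed.

Lemma transport_perm_out (U V : finType) (f : U -> V) (f_inj : injective f)
  (s : {perm U}) (x : V) : x \notin codom f -> transport_perm f_inj s x = x.
Proof. by move=> xNf; rewrite permE transport_fun_out. Qed.

Lemma transport_permM (U V : finType) (f : U -> V) (f_inj : injective f)
  (s t : {perm U}) :
  transport_perm f_inj (s * t)%g
  = (transport_perm f_inj s * transport_perm f_inj t)%g.
Proof.
apply/permP => x; rewrite permM.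
have [/codomP[u ->] | xNf] := boolP (x \in codom f).
  by rewrite !transport_permE permM.
by rewrite !transport_perm_out.
Qed.

Lemma transport_tperm (U V : finType) (f : U -> V) (f_inj : injective f)
  (u v : U) : transport_perm f_inj (tperm u v) = tperm (f u) (f v).
Proof.
apply/permP => x.
have [/codomP[w ->] | xNf] := boolP (x \in codom f).
  by rewrite transport_permE; exact: (inj_tperm _ _ _ f_inj).
rewrite transport_perm_out // tpermD //.
  by apply: contraNneq xNf => <-; rewrite codom_f.
by apply: contraNneq xNf => <-; rewrite codom_f.
Qed.

(** Transport is a morphism sending transpositions to transpositions. *)
Lemma odd_transport_perm (U V : finType) (f : U -> V) (f_inj : injective f)
  (s : {perm U}) : transport_perm f_inj s = s :> bool.
Proof.
have [ts -> /=] := prod_tpermP s.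
elim: ts => [_ | [u v] ts IHts /= /andP[uDv dts]].
  rewrite !big_nil odd_perm1; suff -> : transport_perm f_inj 1 = 1%g.
    by rewrite odd_perm1.
  apply: (mulgI (transport_perm f_inj 1)).
  by rewrite -transport_permM !mulg1.
rewrite !big_cons transport_permM transport_tperm !odd_permM !odd_tperm IHts //.
by rewrite (inj_eq f_inj).
Qed.

Lemma transport_perm_inj (U V : finType) (f : U -> V) (f_inj : injective f) :
  injective (transport_perm f_inj).
Proof.
move=> s t st; apply/permP => u; apply: (f_inj).
by rewrite -!(transport_permE f_inj) st.
Qed.

Lemma im_transport_perm (U V : finType) (f : U -> V) (f_inj : injective f)
  (t : {perm V}) :
  (t \in transport_perm f_inj @: setT) = perm_on [set f u | u in U] t.
Proof.
apply/imsetP/idP => [[s _ ->] | tD].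
  apply/subsetP => x; rewrite inE; apply: contraNT => xNf.
  rewrite transport_perm_out //; apply: contraNN xNf => /codomP[u ->].
  exact: imset_f.
have ex_pre u : exists v, f v == t (f u).
  have : t (f u) \in [set f u | u in U] by rewrite perm_closed // imset_f.
  by case/imsetP=> v _ ->; exists v.
pose g u := xchoose (ex_pre u).
have fg u : f (g u) = t (f u) by apply/eqP; exact: (xchooseP (ex_pre u)).
have g_inj : injective g.
  move=> u v guv; apply: (f_inj); apply: (can_inj (permK t)).
  by rewrite -!fg guv.
exists (perm g_inj) => //; apply/permP => x.
have [/codomP[u ->] | xNf] := boolP (x \in codom f).
  by rewrite transport_permE permE fg.
rewrite transport_perm_out // (out_perm tD) //.
by apply: contraNN xNf => /imsetP[u _ ->]; rewrite codom_f.
Qed.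

(** Leibniz's formula, with the sum over the permutations that are the identity
    outside the image of the indexing. *)
Lemma det_along_injection (R : comNzRingType) (V : finType) (n : nat)
  (f : 'I_n -> V) (f_inj : injective f) (M : V -> V -> R) :
  (\det (\matrix_(i < n, j < n) M (f i) (f j))
   = \sum_(s : {perm V} | perm_on [set f i | i in 'I_n] s)
       (-1) ^+ s * \prod_(x in [set f i | i in 'I_n]) M x (s x))%R.
Proof.
rewrite /determinant.
under [RHS]eq_bigl => s do rewrite -(im_transport_perm f_inj).
rewrite big_imset /=; last by move=> s t _ _; exact: transport_perm_inj.
apply: eq_big => [s | s _]; first by rewrite inE.
rewrite odd_transport_perm; congr (_ * _)%R.
rewrite big_imset /=; last by move=> i j _ _; exact: f_inj.
by apply: eq_bigr => i _; rewrite mxE transport_permE.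
Qed.

(** * Signs, orbits and the coefficients of the characteristic polynomial *)

Definition moved (V : finType) (s : {perm V}) : {set V} := [set x | s x != x].
Definition nontrivial_orbits (V : finType) (s : {perm V}) : {set {set V}} :=
  porbit s @: moved s.

Lemma moved_stable (V : finType) (s : {perm V}) (x : V) :
  (s x \in moved s) = (x \in moved s).
Proof. by rewrite !inE (inj_eq perm_inj). Qed.

Lemma moved_porbit (V : finType) (s : {perm V}) (x y : V) :
  y \in porbit s x -> (y \in moved s) = (x \in moved s).
Proof.
case/porbitP=> i ->; rewrite permX; elim: i => //= i IHi.
by rewrite moved_stable.
Qed.

Lemma fixed_porbit (V : finType) (s : {perm V}) (x : V) :
  x \notin moved s -> porbit s x = [set x].
Proof.
rewrite inE negbK => /eqP sx; apply/setP => y; rewrite inE.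
apply/porbitP/eqP => [[i ->] | ->]; last by exists 0; rewrite perm1.
by rewrite permX; elim: i => //= i ->.
Qed.

Lemma partition_nontrivial_orbits (V : finType) (s : {perm V}) :
  partition (nontrivial_orbits s) (moved s).
Proof.
suff -> : nontrivial_orbits s
  = equivalence_partition (fun x y => y \in porbit s x) (moved s).
  apply: equivalence_partitionP => x y z _ _ _; split; first exact: porbit_id.
  rewrite -eq_porbit_mem => /eqP yx.
  by rewrite !(porbit_sym s z) -!eq_porbit_mem yx.
apply: eq_in_imset => x mx; apply/setP => y; rewrite inE.
case: (boolP (y \in porbit s x)) => [/moved_porbit -> // | _];
  by rewrite ?mx // andbF.
Qed.

(** The sign is defined from the number of all orbits, and the trivial ones are
    the fixed points. *)
Lemma odd_perm_orbits (V : finType) (s : {perm V}) :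
  odd_perm s = odd #|moved s| (+) odd #|nontrivial_orbits s|.
Proof.
have -> : odd_perm s = odd #|V| (+) odd #|porbits s| by [].
have -> : porbits s = nontrivial_orbits s :|: set1 @: (~: moved s).
  apply/setP => B; rewrite inE; apply/imsetP/orP => [[x _ ->] | ].
    have [mx | mx] := boolP (x \in moved s); first by left; apply: imset_f.
    by right; rewrite fixed_porbit //; apply: imset_f; rewrite inE.
  case=> /imsetP[x mx ->]; exists x => //.
  by rewrite fixed_porbit //; rewrite inE in mx.
have disj : [disjoint nontrivial_orbits s & set1 @: (~: moved s)].
  apply/pred0P => B /=; apply/negP => /andP[/imsetP[x mx ->] /imsetP[y]].
  rewrite inE => my /setP/(_ x); rewrite porbit_id inE.
  by move/esym/eqP=> xy; rewrite -xy mx in my.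
move: (leq_card_setU (nontrivial_orbits s) (set1 @: (~: moved s))) => [_].
rewrite disj => /eqP ->.
rewrite (card_imset _ set1_inj) -(cardsC (moved s)) !oddD.
by rewrite addbACA addbb addbF.
Qed.

Definition follows (V : finType) (e : rel V) (s : {perm V}) : bool :=
  [forall x in moved s, e x (s x)].

Lemma moved_perm_on (V : finType) (D : {set V}) (s : {perm V}) :
  perm_on D s = (moved s \subset D).
Proof. by apply: eq_subset => x; rewrite !inE. Qed.

Local Open Scope ring_scope.

(** Sachs's coefficient theorem.  The diagonal of the adjacency matrix vanishes,
    so a fixed point of a permutation gives a factor ['X] and a moved point the
    constant [- e x (s x)]. *)
Lemma coef_char_poly_adj (R : comNzRingType) (V : finType) (D : {set V})
  (e : rel V) (e_irr : irreflexive e) (eD : forall x y, e x y -> x \in D)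
  (i : nat) (iD : (i <= #|D|)%N) :
  (char_poly (\matrix_(a < #|D|, b < #|D|)
      (e (enum_val a) (enum_val b))%:R : 'M[R]_#|D|))`_(#|D| - i)
  = \sum_(s : {perm V} | follows e s && (#|moved s| == i))
       (-1) ^+ #|nontrivial_orbits s|.
Proof.
pose M (x y : V) : {poly R} := (if x == y then 'X else 0) - ((e x y)%:R)%:P.
have -> : char_poly (\matrix_(a < #|D|, b < #|D|)
      (e (enum_val a) (enum_val b))%:R : 'M[R]_#|D|)
   = \det (\matrix_(a < #|D|, b < #|D|)
             M (@enum_val V (mem D) a) (@enum_val V (mem D) b)).
  congr (\det _); apply/matrixP => a b; rewrite !mxE /M (inj_eq enum_val_inj).
  by case: eqP.
rewrite det_along_injection; last exact: enum_val_inj.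
have -> : [set @enum_val V (mem D) a | a in 'I_#|D|] = D.
  apply/setP => x; apply/imsetP/idP => [[a _ ->] | xD]; first exact: enum_valP.
  by exists (enum_rank_in xD x); rewrite ?enum_rankK_in.
have prodE (s : {perm V}) : perm_on D s ->
  \prod_(x in D) M x (s x)
  = (if follows e s then (-1) ^+ #|moved s| else 0) *: 'X^(#|D| - #|moved s|).
  rewrite moved_perm_on => msD.
  rewrite (bigID (mem (moved s))) /=.
  have -> : \prod_(x in D | x \notin moved s) M x (s x)
          = 'X^(#|D| - #|moved s|).
    transitivity (\prod_(x in D :\: moved s) ('X : {poly R})).
      apply: eq_big => [x | x]; first by rewrite in_setD andbC.
      case/andP=> _; rewrite inE negbK => /eqP ->.
      by rewrite /M eqxx e_irr subr0.
    by rewrite prodr_const cardsD (setIidPr msD).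
  have -> : \prod_(x in D | x \in moved s) M x (s x)
          = (\prod_(x in moved s) (- (e x (s x))%:R))%:P.
    rewrite rmorph_prod; apply: eq_big => [x | x].
      by apply: andb_idl => /(subsetP msD).
    by case/andP=> _; rewrite inE eq_sym /M => /negPf ->; rewrite sub0r rmorphN.
  rewrite mul_polyC; congr (_ *: _).
  case: ifP => [/forall_inP fs | /negbT].
    by rewrite (eq_bigr (fun=> -1)) ?prodr_const // => x /fs ->.
  rewrite negb_forall => /existsP[x]; rewrite negb_imply => /andP[mx /negPf ex].
  by rewrite (bigD1 x) //= ex oppr0 mul0r.
rewrite coef_sum big_mkcond [RHS]big_mkcond; apply: eq_bigr => s _.
case: ifPn => [sD | ]; last first.
  rewrite moved_perm_on => sND; case: ifPn => // /andP[/forall_inP fs _].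
  by case/negP: sND; apply/subsetP => x /fs /eD.
rewrite prodE // -[(-1) ^+ s](rmorph_sign (@polyC R)) mul_polyC !coefZ coefXn.
have msD : (#|moved s| <= #|D|)%N by rewrite subset_leq_card -?moved_perm_on.
have -> : (#|D| - i == #|D| - #|moved s|)%N = (#|moved s| == i).
  by rewrite (eqn_sub2lE iD msD) eq_sym.
case: ifP => [_ | _]; last by rewrite mul0r mulr0.
case: eqP => _; rewrite ?mulr0 // mulr1 odd_perm_orbits signr_addb !signr_odd.
by rewrite mulrC mulrA -expr2 sqrr_sign mul1r.
Qed.

Local Close Scope ring_scope.

(** * Cyclic and involutive permutations *)

(** The permutations with a single nontrivial orbit, of size [n]: the cycles of
    length [n] of the graph together with a direction. *)
Definition cyclic_perms (V : finType) (e : rel V) (n : nat) : {set {perm V}} :=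
  [set s | [&& follows e s, 2 < n, #|moved s| == n
             & [forall x in moved s, porbit s x == moved s]]].

Definition involutive_perms (V : finType) (e : rel V) (n : nat) :
    {set {perm V}} :=
  [set s | [&& follows e s, #|moved s| == n & [forall x, s (s x) == x]]].

Lemma cyclic_permsP (V : finType) (e : rel V) (n : nat) (s : {perm V}) :
  reflect [/\ follows e s, 2 < n, #|moved s| = n
            & forall x, x \in moved s -> porbit s x = moved s]
          (s \in cyclic_perms e n).
Proof.
rewrite inE; apply: (iffP and4P) => -[-> -> ms os]; split => //.
- exact/eqP.
- by move=> x mx; apply/eqP; move/forall_inP: os; apply.
- exact/eqP.
- by apply/forall_inP => x mx; apply/eqP/os.
Qed.

Lemma porbit_moved (V : finType) (s : {perm V}) (x : V) :
  (x \in moved s) = (1 < #|porbit s x|).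
Proof.
have [mx | mx] := boolP (x \in moved s); last by rewrite fixed_porbit ?cards1.
have sub : [set x; s x] \subset porbit s x.
  by rewrite subUset !sub1set porbit_id (mem_porbit s 1).
apply/esym/(leq_trans _ (subset_leq_card sub)).
by rewrite cards2 eq_sym; rewrite inE in mx; rewrite mx.
Qed.

Lemma porbit_sub_moved (V : finType) (s : {perm V}) (x : V) :
  x \in moved s -> porbit s x \subset moved s.
Proof. by move=> mx; apply/subsetP => y /moved_porbit ->. Qed.

Lemma involutive_or_long_orbit (V : finType) (s : {perm V}) :
  (forall x, s (s x) = x) \/ exists x, 2 < #|porbit s x|.
Proof.
have [/forallP inv | ] := boolP [forall x, s (s x) == x].
  by left=> x; apply/eqP.
rewrite negb_forall => /existsP[x ssx]; right; exists x.
have sx : s x != x by apply: contraNneq ssx => sx; rewrite !sx.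
suff /card_uniqP c3 : uniq [:: x; s x; s (s x)].
  rewrite -[X in X <= _]/(size [:: x; s x; s (s x)]) -c3.
  apply: subset_leq_card; apply/subsetP => y; rewrite !inE.
  case/or3P=> /eqP ->; [exact: porbit_id | exact: (mem_porbit s 1) | ].
  by rewrite (_ : s (s x) = (s ^+ 2)%g x) ?mem_porbit // permX.
by rewrite /= !inE negb_or (inj_eq perm_inj) !(eq_sym x) ssx sx.
Qed.

(** The nontrivial orbits partition the moved points, so they cannot all be
    even; an odd nontrivial orbit has at least three points. *)
Lemma exists_odd_orbit (V : finType) (s : {perm V}) :
  odd #|moved s| -> exists2 x, odd #|porbit s x| & 2 < #|porbit s x|.
Proof.
move=> odd_ms; suff [x mx ox] : exists2 x, x \in moved s & odd #|porbit s x|.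
  exists x => //; rewrite porbit_moved in mx.
  by case: #|_| ox mx => [|[|[|]]].
apply/exists_inP; apply: contraLR odd_ms.
rewrite negb_exists => /forallP ev.
rewrite (card_partition (partition_nontrivial_orbits s)) big_mkcond /=.
elim/big_ind: _ => // [a b | A _]; first by rewrite oddD => /negPf -> /negPf ->.
case: ifP => // /imsetP[x mx ->]; move: (ev x); by rewrite mx.
Qed.

(** This is how shortness of a permutation forces it to be a single cycle: an
    orbit as large as the set of moved points exhausts it. *)
Lemma full_orbit_cyclic (V : finType) (e : rel V) (s : {perm V}) (x : V) :
  follows e s -> 2 < #|porbit s x| -> #|moved s| <= #|porbit s x| ->
  s \in cyclic_perms e #|moved s|.
Proof.
move=> fs x3 le_x.
have mx : x \in moved s by rewrite porbit_moved ltnW.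
have ox : porbit s x = moved s by apply/eqP; rewrite eqEcard porbit_sub_moved.
apply/cyclic_permsP; split => //; first by rewrite -ox.
by move=> y; rewrite -{1}ox -eq_porbit_mem ox => /eqP.
Qed.

Lemma cyclic_perm_moved (V : finType) (e : rel V) (n : nat) (s : {perm V}) :
  s \in cyclic_perms e n -> exists x, x \in moved s.
Proof.
case/cyclic_permsP=> _ n3 ms _.
by apply/set0Pn; rewrite -card_gt0 ms (ltn_trans _ n3).
Qed.

Lemma nontrivial_orbits_cyclic (V : finType) (e : rel V) (n : nat)
  (s : {perm V}) :
  s \in cyclic_perms e n -> nontrivial_orbits s = [set moved s].
Proof.
move=> sC; have [x mx] := cyclic_perm_moved sC.
have [_ _ _ os] := cyclic_permsP _ _ _ sC; apply/setP => B; rewrite inE.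
apply/imsetP/eqP => [[y my ->] | ->]; first exact: os.
by exists x => //; rewrite os.
Qed.

Lemma porbit_involution (V : finType) (s : {perm V}) (x : V) :
  s (s x) = x -> porbit s x = [set x; s x].
Proof.
move=> ssx; apply/setP => y; rewrite !inE; apply/porbitP/orP => [[i ->] | ].
  rewrite permX; elim: i => [ | i IHi]; first by left.
  by case: IHi => /eqP /= ->; rewrite ?ssx eqxx; [right | left].
by case=> /eqP ->; [exists 0 | exists 1%N]; rewrite ?perm1 ?expg1.
Qed.

Lemma card_moved_involution (V : finType) (s : {perm V}) :
  (forall x, s (s x) = x) -> #|moved s| = #|nontrivial_orbits s| * 2.
Proof.
move=> inv; apply: card_uniform_partition (partition_nontrivial_orbits s).
move=> B /imsetP[x mx ->]; rewrite porbit_involution // cards2 eq_sym.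
by rewrite inE in mx; rewrite mx.
Qed.

Lemma involutive_permsP (V : finType) (e : rel V) (n : nat) (s : {perm V}) :
  reflect [/\ follows e s, #|nontrivial_orbits s| * 2 = n
            & forall x, s (s x) = x]
          (s \in involutive_perms e n).
Proof.
rewrite inE; apply: (iffP and3P) => [[-> /eqP <- /forallP inv] | [-> ms inv]].
  have inv' x : s (s x) = x by apply/eqP.
  by split=> //; rewrite card_moved_involution.
split; rewrite // ?card_moved_involution ?ms //.
by apply/forallP => x; apply/eqP.
Qed.

Lemma cyclic_not_involutive (V : finType) (e e' : rel V) (m n : nat) :
  [disjoint involutive_perms e m & cyclic_perms e' n].
Proof.
apply/pred0P => s /=; apply/negP => /andP[/involutive_permsP[_ _ inv]].
move=> sC; have [_ n3 ms _] := cyclic_permsP _ _ _ sC.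
move: n3; rewrite -ms card_moved_involution // (nontrivial_orbits_cyclic sC).
by rewrite cards1.
Qed.

Local Open Scope ring_scope.

Lemma sum_cyclic_perms (R : comNzRingType) (V : finType) (e : rel V) (n : nat) :
  \sum_(s in cyclic_perms e n) (-1) ^+ #|nontrivial_orbits s|
  = - #|cyclic_perms e n|%:R :> R.
Proof.
rewrite (eq_bigr (fun=> -1)) ?sumr_const ?mulNrn // => s sC.
by rewrite (nontrivial_orbits_cyclic sC) cards1.
Qed.

Lemma sum_involutive_perms (R : comNzRingType) (V : finType) (e : rel V)
  (n : nat) :
  \sum_(s in involutive_perms e n) (-1) ^+ #|nontrivial_orbits s|
  = (if odd n then 0 else (-1) ^+ n./2 * #|involutive_perms e n|%:R) :> R.
Proof.
case: ifPn => [odd_n | _].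
  rewrite big_pred0 // => s; apply/negP => /involutive_permsP[_ sn _].
  by move: odd_n; rewrite -sn oddM andbF.
rewrite (eq_bigr (fun=> (-1) ^+ n./2)) ?sumr_const ?mulr_natr //.
by move=> s /involutive_permsP[_ <- _]; rewrite muln2 doubleK.
Qed.

(** In odd degree no involution moves the right number of points, and only the
    odd orbits matter. *)
Lemma sum_follows_odd (R : comNzRingType) (V : finType) (e : rel V) (n : nat) :
  odd n ->
  (forall s x, follows e s -> 2 < #|porbit s x| -> odd #|porbit s x| ->
     n <= #|porbit s x|)%N ->
  \sum_(s : {perm V} | follows e s && (#|moved s| == n))
     (-1) ^+ #|nontrivial_orbits s|
  = - #|cyclic_perms e n|%:R :> R.
Proof.
move=> odd_n short; rewrite -sum_cyclic_perms; apply: eq_bigl => s.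
apply/andP/idP => [[fs /eqP ms] | /cyclic_permsP[-> _ -> _] //].
have [x ox x3] : exists2 x, odd #|porbit s x| & (2 < #|porbit s x|)%N.
  by apply: exists_odd_orbit; rewrite ms.
by rewrite -ms (full_orbit_cyclic (x := x)) // ms short.
Qed.

(** Either all orbits have at most two points, or one of them has at least
    three, hence at least [n], and is the whole set of moved points. *)
Lemma sum_follows (R : comNzRingType) (V : finType) (e : rel V) (n : nat) :
  (forall s x, follows e s -> 2 < #|porbit s x| -> n <= #|porbit s x|)%N ->
  \sum_(s : {perm V} | follows e s && (#|moved s| == n))
     (-1) ^+ #|nontrivial_orbits s|
  = (if odd n then 0 else (-1) ^+ n./2 * #|involutive_perms e n|%:R)
    - #|cyclic_perms e n|%:R :> R.
Proof.
move=> short; rewrite -sum_cyclic_perms -sum_involutive_perms.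
rewrite -bigU /=; last exact: cyclic_not_involutive.
apply: eq_bigl => s; rewrite inE.
apply/andP/orP => [[fs /eqP ms] | ]; last first.
  case=> [ | /cyclic_permsP[-> _ -> _] //].
  by rewrite inE => /and3P[-> -> _].
have [inv | [x x3]] := involutive_or_long_orbit s.
  by left; apply/involutive_permsP; rewrite -card_moved_involution.
by right; rewrite -ms (full_orbit_cyclic (x := x)) // ms short.
Qed.

Local Close Scope ring_scope.

(** * Involutions and matchings *)

Lemma nontrivial_orbits_inj (V : finType) (e : rel V) (n : nat) :
  {in involutive_perms e n &, injective (@nontrivial_orbits V)}.
Proof.
move=> s t /involutive_permsP[_ _ sI] /involutive_permsP[_ _ tI] st.
have ms : moved s = moved t.
  by rewrite -(cover_partition (partition_nontrivial_orbits s)) st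
             (cover_partition (partition_nontrivial_orbits t)).
apply/permP => x; have [mx | mx] := boolP (x \in moved s); last first.
  have mt : x \notin moved t by rewrite -ms.
  by move: mx mt; rewrite !inE !negbK => /eqP -> /eqP ->.
have : porbit s x \in nontrivial_orbits t by rewrite -st imset_f.
case/imsetP=> y _ sy.
have : porbit t x = porbit s x.
  apply/esym; rewrite sy; apply/eqP.
  by rewrite eq_sym eq_porbit_mem -sy porbit_id.
rewrite !porbit_involution // => /setP/(_ (s x)); rewrite !inE eqxx orbT.
by rewrite inE in mx; rewrite (negPf mx) => /eqP.
Qed.

(** A matching is recovered as the set of nontrivial orbits of the involution
    exchanging the two ends of each of its members. *)
Lemma involution_of_matching (V : finType) (e : rel V) (EE : {set {set V}}) :
  symmetric e -> irreflexive e -> trivIset EE ->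
  (forall P, P \in EE -> exists x y, P = [set x; y] /\ e x y) ->
  exists2 s, s \in involutive_perms e (#|EE| * 2) & nontrivial_orbits s = EE.
Proof.
move=> e_sym e_irr tI EEe.
(* [f x] is the other end of the member containing [x], if there is one. *)
pose f x := odflt x [pick y | ([set x; y] \in EE) && (y != x)].
have same P Q x : P \in EE -> Q \in EE -> x \in P -> x \in Q -> P = Q.
  move=> PE QE xP xQ; apply/eqP; apply: contraTT xP => PQ.
  have /trivIsetP/(_ P Q PE QE PQ) := tI.
  by move/disjoint_setI0/setP/(_ x); rewrite !inE xQ andbT => ->.
have fP x y : [set x; y] \in EE -> y != x -> f x = y.
  move=> xyE yx; rewrite /f.
  case: pickP => [z /andP[xzE zx] | /(_ y)]; last first.
    by rewrite xyE yx.
  have /setP/(_ z) : [set x; y] = [set x; z].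
    by apply: (same _ _ x) => //; rewrite !inE eqxx.
  by rewrite !inE eqxx orbT (negPf zx) => /eqP.
have fE x : f x != x -> [set x; f x] \in EE.
  by rewrite /f; case: pickP => [z /andP[] | ] //=; rewrite eqxx.
have ff x : f (f x) = x.
  have [fx | fx] := eqVneq (f x) x; first by rewrite !fx.
  by apply: (fP (f x) x); [rewrite setUC fE | rewrite eq_sym].
pose s := perm (can_inj ff).
have sEE : nontrivial_orbits s = EE.
  apply/setP => P; apply/imsetP/idP => [[x] | PE].
    rewrite inE permE => /fE xE ->.
    by rewrite porbit_involution !permE ?ff.
  have [x [y [Pxy exy]]] := EEe P PE.
  have yx : y != x by apply: contraTneq exy => ->; rewrite e_irr.
  have fx : f x = y by apply: fP; rewrite -?Pxy.
  exists x; first by rewrite inE permE fx.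
  by rewrite porbit_involution !permE ?ff // fx.
exists s => //; apply/involutive_permsP.
split; [ | by rewrite sEE | by move=> x; rewrite !permE ff].
apply/forall_inP => x; rewrite inE !permE => fx.
have [a [b [ab eab]]] := EEe _ (fE x fx).
have := set21 x (f x); have := set22 x (f x); rewrite ab !inE.
case/orP=> /eqP fxE; case/orP=> /eqP xE; do ?[by case/eqP: fx; rewrite fxE];
  by rewrite fxE xE // e_sym.
Qed.

Lemma matching_of_involution (V : finType) (e : rel V) (n : nat)
  (s : {perm V}) :
  s \in involutive_perms e n ->
  trivIset (nontrivial_orbits s)
  /\ forall P, P \in nontrivial_orbits s -> exists x y, P = [set x; y] /\ e x y.
Proof.
case/involutive_permsP=> /forall_inP fs _ inv; split.
  exact: partition_trivIset (partition_nontrivial_orbits s).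
by move=> P /imsetP[x /fs exs ->]; exists x, (s x); rewrite porbit_involution.
Qed.

(** * Reversing a cyclic permutation *)

Lemma moved_inv (V : finType) (s : {perm V}) : moved s^-1 = moved s.
Proof.
apply/setP => x; rewrite !inE; congr (~~ _).
by apply/eqP/eqP => [{1}<- | {1}<-]; rewrite ?permKV ?permK.
Qed.

Lemma cyclic_perms_inv (V : finType) (e : rel V) (n : nat) (s : {perm V}) :
  symmetric e -> s \in cyclic_perms e n -> (s^-1)%g \in cyclic_perms e n.
Proof.
move=> e_sym /cyclic_permsP[/forall_inP fs n3 ms os].
apply/cyclic_permsP; rewrite moved_inv; split=> // [ | x /os]; last first.
  by rewrite porbitV.
apply/forall_inP => x; rewrite moved_inv => mx.
have := fs (s^-1 x)%g; rewrite permKV e_sym; apply.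
by rewrite -moved_stable permKV.
Qed.

Lemma cyclic_perm_neq_inv (V : finType) (e : rel V) (n : nat) (s : {perm V}) :
  s \in cyclic_perms e n -> s != (s^-1)%g.
Proof.
move=> sC; apply: contraTneq sC => s_inv; apply/negP => sC.
have inv x : s (s x) = x by rewrite {1}s_inv permK.
have [fs _ ms _] := cyclic_permsP _ _ _ sC.
have /pred0P/(_ s)/negP := @cyclic_not_involutive _ e e n n; apply.
rewrite /= sC andbT; apply/involutive_permsP; split=> //.
by rewrite -card_moved_involution.
Qed.

(** * Walks along a permutation *)

Definition adj (T : finType) (H : hypergraph T) : rel {set T} :=
  fun S S' => edge_two_partition H [set S; S'].

Lemma two_partition_union (T : finType) (S S' e : {set T}) :
  two_partition [set S; S'] e -> e = S :|: S'.
Proof.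
case/andP=> /cover_partition <- _.
by rewrite /cover bigcup_setU !big_set1.
Qed.

Lemma adjE (T : finType) (H : hypergraph T) (S S' : {set T}) :
  adj H S S' = (S :|: S' \in edges H) && two_partition [set S; S'] (S :|: S').
Proof.
apply/existsP/andP => [[e /andP[eH Pe]] | [eH Pe]].
  by rewrite -(two_partition_union Pe).
by exists (S :|: S'); rewrite eH.
Qed.

Lemma adj_sym (T : finType) (H : hypergraph T) : symmetric (adj H).
Proof. by move=> S S'; rewrite /adj setUC. Qed.

Lemma adj_irr (T : finType) (H : hypergraph T) : irreflexive (adj H).
Proof. by move=> S; rewrite adjE /two_partition !setUid cards1 !andbF. Qed.

Lemma adj_disjoint (T : finType) (H : hypergraph T) (S S' : {set T}) :
  adj H S S' -> [disjoint S & S'].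
Proof.
move=> SS'; have SnS' : S != S' by apply: contraTneq SS' => ->; rewrite adj_irr.
move: SS'; rewrite adjE => /andP[_ /andP[/partition_trivIset/trivIsetP tI _]].
by apply: tI; rewrite ?set21 ?set22.
Qed.

Lemma adj_parts (T : finType) (H : hypergraph T) (S S' : {set T}) :
  adj H S S' -> S \in parts H.
Proof.
move=> SS'; rewrite !inE; apply/orP; left; apply/existsP.
by exists [set S; S']; rewrite set21 andbT.
Qed.

(** The walk [S, s S, s (s S), ...] of length [n]; the edge of each step is
    forced to be the union of its two parts. *)
Definition traversal (T : finType) (s : {perm {set T}}) (S : {set T})
    (n : nat) : walk T :=
  (S, [seq (S' :|: s S', s S') | S' <- traject s S n]).

Lemma map_traject (U : Type) (f : U -> U) (x : U) (n : nat) :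
  map f (traject f x n) = traject f (f x) n.
Proof. by elim: n x => //= n IHn x; rewrite IHn. Qed.

Lemma belast_traject (U : Type) (f : U -> U) (x : U) (n : nat) :
  belast x (traject f (f x) n) = traject f x n.
Proof. by elim: n x => //= n IHn x; rewrite IHn. Qed.

Lemma traversal_parts (T : finType) (s : {perm {set T}}) (S : {set T})
  (n : nat) :
  unzip2 (traversal s S n).2 = traject s (s S) n.
Proof. by rewrite -map_traject /unzip2 -map_comp. Qed.

Lemma traversal_edges (T : finType) (s : {perm {set T}}) (S : {set T})
  (n : nat) :
  walk_edges (traversal s S n) = [seq S' :|: s S' | S' <- traject s S n].
Proof. by rewrite /walk_edges /unzip1 -map_comp. Qed.

Lemma size_traversal (T : finType) (s : {perm {set T}}) (S : {set T})
  (n : nat) :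
  size (traversal s S n).2 == n.
Proof. by rewrite size_map size_traject. Qed.

Lemma traversal_last (T : finType) (s : {perm {set T}}) (S : {set T})
  (n : nat) :
  walk_last (traversal s S n) = iter n s S.
Proof. by rewrite /walk_last traversal_parts last_traject. Qed.

Lemma traversal_belast (T : finType) (s : {perm {set T}}) (S : {set T})
  (n : nat) :
  walk_belast (traversal s S n) = traject s S n.
Proof. by rewrite /walk_belast traversal_parts belast_traject. Qed.

Lemma traversal_exact_walk (T : finType) (H : hypergraph T)
  (s : {perm {set T}}) (S : {set T}) (n : nat) :
  exact_walk H (traversal s S n)
  = all (fun S' => adj H S' (s S')) (traject s S n).
Proof.
rewrite /exact_walk /=; elim: n S => //= n IHn S.
by rewrite IHn andbA -adjE.
Qed.

Lemma three_values (U : eqType) (w : seq U) (a b c : U) :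
  a \in w -> b \in w -> c \in w -> a != b -> a != c -> b != c ->
  3 <= size (undup w).
Proof.
move=> aw bw cw ab ac bc; apply: (@uniq_leq_size _ [:: a; b; c]).
  by rewrite /= !inE negb_or ab ac bc.
by move=> x; rewrite !inE mem_undup => /or3P[] /eqP ->.
Qed.

(** A walk [A, B, C, D, E] whose edges alternate between two values comes back
    to [A] after two steps: [C] avoids [B], so it lies in [A], and a point of [A]
    outside [C] would be in [D], hence in [B] or [C], and it is in neither. *)
Lemma alternating_unions (T : finType) (A B C D E : {set T}) :
  [disjoint A & B] -> [disjoint B & C] ->
  C :|: D = A :|: B -> D :|: E = B :|: C -> A = C.
Proof.
move=> AB BC /setP CD /setP DE; apply/setP => v.
move: (CD v) (DE v) (disjoint_setI0 AB) (disjoint_setI0 BC).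
move=> CDv DEv /setP/(_ v) ABv /setP/(_ v); move: CDv DEv ABv.
by rewrite !inE; do 5!case: (v \in _).
Qed.

(** Consecutive edges differ because parts two steps apart are distinct.  If the
    third edge repeats the first one, then the fourth cannot repeat the second
    one, by [alternating_unions]. *)
Lemma three_edges (T : finType) (H : hypergraph T) (s : {perm {set T}})
  (S : {set T}) :
  follows (adj H) s -> 2 < #|porbit s S| ->
  3 <= size (undup [seq S' :|: s S' | S' <- traject s S #|porbit s S|]).
Proof.
move=> /forall_inP fs S3; set n := #|_| in S3 *.
have mS : S \in moved s by rewrite porbit_moved ltnW.
pose x i := iter i s S.
have xS i : x i \in porbit s S by rewrite /x -permX mem_porbit.
have edge_x i : x i :|: x i.+1 \in [seq S' :|: s S' | S' <- traject s S n].
  by apply/mapP; exists (x i); rewrite -?porbit_traject.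
have disj i : [disjoint x i & x i.+1].
  by apply: adj_disjoint (fs _ _); rewrite (moved_porbit (xS i)).
have x02 i : x i != x i.+2.
  apply: contraTneq S3 => xi; rewrite -leqNgt /n.
  have <- : porbit s (x i) = porbit s S by apply/eqP; rewrite eq_porbit_mem.
  by rewrite porbit_involution ?cards2 -?xi //; case: eqP.
have edge_neq i : x i :|: x i.+1 != x i.+1 :|: x i.+2.
  apply: contraNneq (x02 i) => xi; apply/eqP.
  rewrite -(setDidPl (disj i)).
  rewrite -[RHS](setDidPl (_ : [disjoint x i.+2 & x i.+1])).
    have := congr1 (fun E => E :\: x i.+1) xi.
    by rewrite !setDUl setDv setU0 set0U.
  by rewrite disjoint_sym.
have [e20 | e20] := eqVneq (x 2 :|: x 3) (x 0 :|: x 1); last first.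
  apply: three_values (edge_x 0) (edge_x 1) (edge_x 2) _ _ _ => //.
  by rewrite eq_sym.
apply: three_values (edge_x 0) (edge_x 1) (edge_x 3) _ _ _ => //.
  by rewrite -e20.
apply: contraNneq (x02 0) => e31; apply/eqP.
exact: alternating_unions (disj 0) (disj 1) e20 (esym e31).
Qed.

Lemma traversal_exact_cycle (T : finType) (H : hypergraph T)
  (s : {perm {set T}}) (S : {set T}) :
  follows (adj H) s -> 2 < #|porbit s S| ->
  exact_cycle H (traversal s S #|porbit s S|).
Proof.
move=> fs S3; apply/and4P; split.
- rewrite traversal_exact_walk; apply/allP => S'.
  rewrite -porbit_traject => S's.
  move/forall_inP: fs; apply.
  by rewrite (moved_porbit S's) porbit_moved ltnW.
- by rewrite traversal_edges (three_edges fs).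
- by rewrite traversal_last iter_porbit.
- by rewrite traversal_belast uniq_traject_porbit.
Qed.

Lemma exact_walk_along (T : finType) (H : hypergraph T) (s : {perm {set T}})
  (c : walk T) :
  exact_walk H c -> fpath s c.1 (unzip2 c.2) -> c = traversal s c.1 (size c.2).
Proof.
case: c => S w /= Hw sw; congr (_, _); move: Hw sw; rewrite /exact_walk /=.
elim: w S => //= -[e S'] w IHw S /and3P[_ Pe Hw] /andP[/= /eqP sS sw].
by rewrite sS (two_partition_union Pe) -IHw.
Qed.

(** The permutation is the successor map of the cyclic sequence of parts. *)
Lemma exact_cycle_traversal (T : finType) (H : hypergraph T) (c : walk T) :
  exact_cycle H c ->
  exists s, [/\ s \in cyclic_perms (adj H) (walk_length c), c.1 \in moved s
               & c = traversal s c.1 (walk_length c)].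
Proof.
case/and4P=> Hc c3 /eqP c_closed.
have c_gt2 : 2 < size c.2.
  by rewrite (leq_trans c3) // (leq_trans (size_undup _)) // size_map.
have size_p : size (walk_belast c) = size c.2 by rewrite size_belast size_map.
have : c.1 :: unzip2 c.2 = rcons (walk_belast c) c.1.
  by rewrite {2}c_closed -lastI.
case: (walk_belast c) size_p => [ | a q] size_p [].
  by rewrite -size_p in c_gt2.
move=> <- qE; set p := c.1 :: q => p_uniq.
pose s := perm (can_inj (prev_next p_uniq)).
have s_next : s =1 next p by move=> S; rewrite permE.
have sp : fpath s c.1 (unzip2 c.2).
  have := cycle_next p_uniq; rewrite {2}/p qE /=.
  by rewrite (eq_path (e' := frel s)) // => y z /=; rewrite s_next.
have cE := exact_walk_along Hc sp.
have pE : p = traject s c.1 (walk_length c).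
  rewrite -(traversal_belast s c.1) -cE /walk_belast qE -[LHS]/(c.1 :: q).
  by rewrite -(belast_rcons c.1 q c.1).
have adj_s S : S \in p -> adj H S (s S).
  by move: S; apply/allP; rewrite pE -traversal_exact_walk -cE.
have ms : moved s = [set S in p].
  apply/setP => S; rewrite /moved in_set [RHS]in_set.
  apply/idP/idP => [ | /adj_s]; last first.
    by apply: contraTneq => ->; rewrite adj_irr.
  by apply: contraNT => Sp; rewrite s_next next_nth (negPf Sp).
have c1 : c.1 \in moved s by rewrite ms in_set mem_head.
have card_ms : #|moved s| = walk_length c.
  by rewrite ms cardsE (card_uniqP p_uniq) /walk_length -size_p.
exists s; split => //; apply/cyclic_permsP; split => //.
  by apply/forall_inP => S; rewrite ms in_set => /adj_s.
have o1 : porbit s c.1 = moved s.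
  apply/eqP; rewrite eqEsubset porbit_sub_moved //.
  apply/subsetP => S; rewrite ms in_set pE => /trajectP[i _ ->].
  by rewrite -permX mem_porbit.
by move=> S; rewrite -{1}o1 -eq_porbit_mem o1 => /eqP.
Qed.

(** * Counting exact cycles *)

Definition ntraversal (T : finType) (s : {perm {set T}}) (n : nat)
    (S : {set T}) : {set T} * n.-tuple ({set T} * {set T}) :=
  (S, Tuple (size_traversal s S n)).

Lemma walk_of_inj (T : finType) (n : nat) : injective (@walk_of T n).
Proof. by move=> [S w] [S' w'] /= [-> /val_inj ->]. Qed.

Lemma exact_cyclesP (T : finType) (H : hypergraph T) (n : nat)
  (c : {set T} * n.-tuple ({set T} * {set T})) :
  reflect (exists s S, [/\ s \in cyclic_perms (adj H) n, S \in moved s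
                          & c = ntraversal s n S])
          (c \in exact_cycles H n).
Proof.
rewrite inE; apply: (iffP idP) => [/exact_cycle_traversal[s] | ].
  rewrite /walk_length size_tuple => -[sC mS cE].
  by exists s, c.1; split => //; apply: walk_of_inj.
case=> s [S [/cyclic_permsP[fs n3 ms os] mS ->]].
rewrite /walk_of /= -[(_, _)]/(traversal s S n).
by rewrite -ms -(os S mS) traversal_exact_cycle // os ?ms.
Qed.

(** A traversal shows where each point of its orbit goes, and everything else is
    fixed. *)
Lemma ntraversal_inj (T : finType) (H : hypergraph T) (n : nat)
  (s s' : {perm {set T}}) (S S' : {set T}) :
  s \in cyclic_perms (adj H) n -> s' \in cyclic_perms (adj H) n ->
  S \in moved s -> S' \in moved s' ->
  ntraversal s n S = ntraversal s' n S' -> s = s'.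
Proof.
move=> /cyclic_permsP[_ _ ms os] /cyclic_permsP[_ _ ms' os'] mS mS' eqW.
have eqS : S = S' by have := congr1 fst eqW.
subst S'; have : traversal s S n = traversal s' S n.
  by have := congr1 (@walk_of _ _) eqW.
move/(congr1 (fun c : walk T => unzip2 c.2)); rewrite !traversal_parts => eqT.
have mem_tr t : #|moved t| = n ->
  (forall S, S \in moved t -> porbit t S = moved t) ->
  S \in moved t -> moved t =i traject t S n.
  by move=> mt ot mSt S'; rewrite -(ot S mSt) porbit_traject ot // mt.
have step i : i < n -> iter i.+1 s S = iter i.+1 s' S.
  move=> i_n; rewrite !iterSr -!(nth_traject _ i_n) eqT.
  by apply: set_nth_default; rewrite size_traject.
have iterE i : i < n -> iter i s S = iter i s' S by case: i => // i /ltnW /step.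
have eq_m : moved s = moved s'.
  apply/setP => S'; rewrite (mem_tr s) // (mem_tr s') //.
  by apply/trajectP/trajectP => -[i i_n ->]; exists i; rewrite // iterE.
apply/permP => S'; have [ | mS''] := boolP (S' \in moved s); last first.
  have := mS''; rewrite {1}eq_m; move: mS''.
  by rewrite !inE !negbK => /eqP -> /eqP ->.
rewrite (mem_tr s) // => /trajectP[i i_n ->].
by rewrite -iterS step // iterS iterE.
Qed.

Lemma rot_traject (U : Type) (f : U -> U) (x : U) (n i : nat) :
  i <= n -> iter n f x = x -> rot i (traject f x n) = traject f (iter i f x) n.
Proof.
move=> i_n fx; rewrite -{1}(subnKC i_n) trajectD.
rewrite -{1}(size_traject f x i) rot_size_cat.
have -> : traject f x i = traject f (iter (n - i) f (iter i f x)) i.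
  by rewrite -iterD subnK // fx.
by rewrite -trajectD subnK.
Qed.

Lemma rev_traject (V : finType) (s : {perm V}) (x : V) (n : nat) :
  rev (traject s (s x) n) = traject (s^-1)%g (iter n s x) n.
Proof.
elim: n => // n IHn; rewrite trajectSr rev_rcons IHn -iterSr.
by rewrite trajectS iterS permK.
Qed.

Lemma walk_shift_traversal (T : finType) (s : {perm {set T}}) (S : {set T})
  (n i : nat) : i <= n -> iter n s S = S ->
  walk_shift i (traversal s S n) = traversal s (iter i s S) n.
Proof.
move=> i_n sS; rewrite /walk_shift /traversal; congr (_, _).
  rewrite /= -map_take take_traject // -[map _ _]/((traversal s S i).2).
  by rewrite traversal_parts last_traject.
by rewrite /= -map_rot rot_traject.
Qed.

Lemma walk_rev_traversal (T : finType) (s : {perm {set T}}) (S : {set T})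
  (n : nat) : iter n s S = S ->
  walk_rev (traversal s S n) = traversal (s^-1)%g S n.
Proof.
move=> sS; rewrite /walk_rev traversal_last sS; congr (_, _).
rewrite traversal_edges traversal_belast -map_rev.
have -> : rev (traject s S n) = map (s^-1)%g (traject (s^-1)%g S n).
  rewrite map_traject -{1}[S](permKV s) rev_traject.
  congr traject; apply: (@perm_inj _ s).
  by rewrite permKV -iterS iterSr permKV.
rewrite -map_comp zip_map; apply: eq_map => S' /=.
by rewrite permKV setUC.
Qed.

(** All the walks around the cycle of [s], from any starting part and in both
    directions. *)
Definition traversals (T : finType) (n : nat) (s : {perm {set T}}) :
    {set {set T} * n.-tuple ({set T} * {set T})} :=
  (ntraversal s n @: moved s) :|: (ntraversal (s^-1)%g n @: moved s).

Lemma iter_cyclic (V : finType) (e : rel V) (n : nat) (s : {perm V}) (x : V) :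
  s \in cyclic_perms e n -> x \in moved s -> iter n s x = x.
Proof. by case/cyclic_permsP=> _ _ <- os /os <-; exact: iter_porbit. Qed.

Lemma moved_cyclicP (V : finType) (e : rel V) (n : nat) (s : {perm V})
  (x y : V) :
  s \in cyclic_perms e n -> x \in moved s ->
  reflect (exists2 i, i < n & y = iter i s x) (y \in moved s).
Proof.
case/cyclic_permsP=> _ _ ms os mx.
by rewrite -(os x mx) porbit_traject os // ms; exact: trajectP.
Qed.

(** Shifting a traversal of [s] gives one of [s] from another starting point,
    and reversing it gives one of [s^-1]; so the equivalence class of a traversal is
    [traversals n s]. *)
Lemma same_cycle_traversals (T : finType) (H : hypergraph T) (n : nat)
  (s : {perm {set T}}) (S : {set T}) :
  s \in cyclic_perms (adj H) n -> S \in moved s ->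
  [set c in exact_cycles H n
     | same_cycle (walk_of (ntraversal s n S)) (walk_of c)]
  = traversals n s.
Proof.
move=> sC mS; have sVC := cyclic_perms_inv (adj_sym H) sC.
have itS := iter_cyclic sC mS.
have mSV : S \in moved s^-1 by rewrite moved_inv.
have itSV := iter_cyclic sVC mSV.
have shiftE i : i < n ->
    (walk_shift i (traversal s S n) = walk_of (ntraversal s n (iter i s S)))
  * (walk_shift i (walk_rev (traversal s S n))
     = walk_of (ntraversal (s^-1)%g n (iter i (s^-1)%g S))).
  by move/ltnW=> i_n; rewrite walk_rev_traversal // !walk_shift_traversal.
apply/setP => c; rewrite inE in_setU; apply/andP/orP.
  case=> _ /existsP[[i /= i_n]].
  have {}i_n : i < n by rewrite -[n](eqP (size_traversal s S n)).
  rewrite -[walk_of (ntraversal s n S)]/(traversal s S n) !shiftE //.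
  case/orP=> /eqP/walk_of_inj ->; [left | right]; apply: imset_f.
    by apply/(moved_cyclicP _ sC mS); exists i.
  by rewrite -moved_inv; apply/(moved_cyclicP _ sVC mSV); exists i.
have lenW i : i < n -> i < walk_length (walk_of (ntraversal s n S)).
  by rewrite /walk_length (eqP (size_traversal s S n)).
case=> /imsetP[S' mS' ->].
  split; first by apply/exact_cyclesP; exists s, S'.
  have /(moved_cyclicP _ sC mS)[i i_n ->] := mS'.
  by apply/existsP; exists (Ordinal (lenW i i_n)); rewrite shiftE ?eqxx.
rewrite -moved_inv in mS'.
split; first by apply/exact_cyclesP; exists (s^-1)%g, S'.
have /(moved_cyclicP _ sVC mSV)[i i_n ->] := mS'.
by apply/existsP; exists (Ordinal (lenW i i_n)); rewrite !shiftE ?eqxx ?orbT.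
Qed.

Lemma num_exact_cyclesE (T : finType) (H : hypergraph T) (n : nat) :
  num_exact_cycles H n = #|traversals n @: cyclic_perms (adj H) n|.
Proof.
rewrite /num_exact_cycles /equivalence_partition; congr #|pred_of_set _|.
apply/setP => B; apply/imsetP/imsetP => [[c] | [s sC ->]].
  case/exact_cyclesP=> s [S [sC mS ->]] ->.
  by exists s => //; exact: same_cycle_traversals.
have [S mS] := cyclic_perm_moved sC.
exists (ntraversal s n S); first by apply/exact_cyclesP; exists s, S.
by rewrite (same_cycle_traversals sC mS).
Qed.

Lemma traversals_eq (T : finType) (H : hypergraph T) (n : nat)
  (s t : {perm {set T}}) :
  s \in cyclic_perms (adj H) n -> t \in cyclic_perms (adj H) n ->
  (traversals n t == traversals n s) = (t \in [set s; s^-1%g]).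
Proof.
move=> sC tC; have sVC := cyclic_perms_inv (adj_sym H) sC.
rewrite !inE; apply/eqP/orP => [ts | [] /eqP -> //]; last first.
  by rewrite /traversals invgK moved_inv setUC.
have [S mS] := cyclic_perm_moved tC.
have : ntraversal t n S \in traversals n s by rewrite -ts in_setU imset_f.
case/setUP=> /imsetP[S' mS']; [left | right]; apply/eqP.
  exact: (ntraversal_inj tC sC mS mS').
by rewrite -moved_inv in mS'; exact: (ntraversal_inj tC sVC mS mS').
Qed.

(** The map from cyclic permutations to classes has the fibres [{s, s^-1}], of
    size two as a cycle of length at least three is not an involution. *)
Lemma card_cyclic_perms (T : finType) (H : hypergraph T) (n : nat) :
  #|cyclic_perms (adj H) n| = 2 * num_exact_cycles H n.
Proof.
rewrite num_exact_cyclesE -sum1_card (partition_big_imset (@traversals T n)) /=.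
rewrite mulnC -sum_nat_const; apply: eq_bigr => _ /imsetP[s sC ->].
rewrite sum1_card -(_ : #|[set s; s^-1%g]| = 2); last first.
  by rewrite cards2 (cyclic_perm_neq_inv sC).
apply: eq_card => t; rewrite unfold_in /=.
have [tC | tNC] := boolP (t \in _); first by rewrite (traversals_eq sC tC).
apply/esym/negP; rewrite !inE => /orP[] /eqP tE; case/negP: tNC; rewrite tE //.
exact: cyclic_perms_inv (@adj_sym T H) sC.
Qed.

Lemma exact_cycles_neq0 (T : finType) (H : hypergraph T) (n : nat) :
  (exact_cycles H n != set0) = (0 < num_exact_cycles H n).
Proof.
rewrite num_exact_cyclesE card_gt0.
apply/set0Pn/set0Pn.
  case=> c /exact_cyclesP[s [S [sC _ _]]].
  by exists (traversals n s); rewrite imset_f.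
case=> _ /imsetP[s sC _].
have [S mS] := cyclic_perm_moved sC.
by exists (ntraversal s n S); apply/exact_cyclesP; exists s, S.
Qed.

Lemma exact_cycles_le_index (T : finType) (H : hypergraph T) (n : nat) :
  exact_cycles H n != set0 -> n <= e_index H.
Proof.
case/set0Pn=> c /exact_cyclesP[s [_ [sC _ _]]].
have [/forall_inP fs _ <- _] := cyclic_permsP _ _ _ sC.
by apply/subset_leq_card/subsetP => S /fs /adj_parts.
Qed.

Lemma long_orbit_exact_cycle (T : finType) (H : hypergraph T)
  (s : {perm {set T}}) (S : {set T}) :
  follows (adj H) s -> 2 < #|porbit s S| ->
  exact_cycles H #|porbit s S| != set0.
Proof.
move=> fs S3; apply/set0Pn; exists (ntraversal s #|porbit s S| S).
by rewrite inE; exact: traversal_exact_cycle.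
Qed.

Lemma edge_two_partition_adj (T : finType) (H : hypergraph T)
  (P : {set {set T}}) :
  edge_two_partition H P -> exists S S', P = [set S; S'] /\ adj H S S'.
Proof.
move=> PH; have [e /andP[_ /andP[_ /cards2P[S [S' [_ PE]]]]]] := existsP PH.
by exists S, S'; rewrite /adj -PE.
Qed.

(** * Coefficients and girths *)

Lemma elementary_matching (T : finType) (H : hypergraph T) (n : nat)
  (EE : {set {set {set T}}}) :
  (exists H', elementary H n H' fset0 EE) <->
  [/\ trivIset EE, forall P, P \in EE -> edge_two_partition H P
    & 2 * #|EE| = n].
Proof.
split=> [[H' [[_ subE] _ EEH' sumE once]] | [tI EEH sumE]].
  rewrite !big_seq_fset0 in sumE once.
  split=> [ | P /EEH' /existsP[e /andP[eH' Pe]] | //].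
    apply/trivIsetP => P Q PE QE; apply: contraR => /pred0Pn[S /andP[SP SQ]].
    have : S \in set0 :|: cover EE by rewrite set0U; apply/bigcupP; exists P.
    move/once; rewrite inE => /cards1P[Z EES].
    have : P \in [set P in EE | S \in P] by rewrite inE PE.
    have : Q \in [set P in EE | S \in P] by rewrite inE QE.
    by rewrite EES !inE => /eqP -> /eqP ->.
  by apply/existsP; exists e; rewrite (msubset_subset subE).
exists H; split; rewrite ?big_seq_fset0 //.
  by split=> //; exact: msubset_refl.
move=> S; rewrite set0U inE => /bigcupP[P PE SP]; apply/cards1P; exists P.
apply/setP => Q; rewrite !inE; apply/andP/eqP => [[QE SQ] | -> //].
apply/eqP; apply: contraTT SQ => QP.
have /disjoint_setI0/setP/(_ S) := trivIsetP tI Q P QE PE QP.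
by rewrite !inE SP andbT => ->.
Qed.

Lemma omegaE (T : finType) (H : hypergraph T) (n : nat) :
  omega H n = #|involutive_perms (adj H) n|.
Proof.
rewrite -(card_in_imset (@nontrivial_orbits_inj _ (adj H) n)).
apply: eq_card => EE; rewrite inE; apply/asboolP/imsetP.
  case/elementary_matching=> tI EEH sumE.
  have [ | s sI sEE] := involution_of_matching (adj_sym H) (@adj_irr T H) tI.
    by move=> P /EEH /edge_two_partition_adj.
  by exists s; rewrite // -sumE mulnC.
case=> s sI ->; have [tI EEe] := matching_of_involution sI.
have [_ sn _] := involutive_permsP _ _ _ sI.
apply/elementary_matching; split=> //; last by rewrite mulnC.
by move=> P /EEe[S [S' [->]]].
Qed.

Local Open Scope ring_scope.

Lemma charcoefE (R : comNzRingType) (T : finType) (H : hypergraph T) (n : nat) :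
  (n <= e_index H)%N ->
  charcoef R H n
  = \sum_(s : {perm {set T}} | follows (adj H) s && (#|moved s| == n))
       (-1) ^+ #|nontrivial_orbits s|.
Proof.
by move=> nk; apply: coef_char_poly_adj nk; [exact: adj_irr | exact: adj_parts].
Qed.

Lemma charcoef_first_odd (R : comNzRingType) (T : finType) (H : hypergraph T)
  (n : nat) :
  odd n -> (n <= e_index H)%N ->
  (forall m, (m < n)%N -> odd m -> exact_cycles H m = set0) ->
  charcoef R H n = - (2 * num_exact_cycles H n)%:R.
Proof.
move=> odd_n nk short.
rewrite charcoefE // sum_follows_odd ?card_cyclic_perms //.
move=> s S fs S3 oS; have := long_orbit_exact_cycle fs S3.
by rewrite leqNgt; apply: contraNN => /short ->.
Qed.

Lemma gamma_first (R : comNzRingType) (T : finType) (H : hypergraph T)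
  (n : nat) :
  (n <= e_index H)%N -> (forall m, (m < n)%N -> exact_cycles H m = set0) ->
  gamma R H n = - (2 * num_exact_cycles H n)%:R.
Proof.
move=> nk short; rewrite /gamma charcoefE // sum_follows ?card_cyclic_perms.
  by rewrite omegaE; case: (odd n); rewrite ?sub0r // addrAC subrr sub0r.
move=> s S fs S3; have := long_orbit_exact_cycle fs S3.
by rewrite leqNgt; apply: contraNN => /short ->.
Qed.

Lemma half_neg_double (R : numFieldType) (m : nat) :
  m%:R = - (1 / 2) * - (2 * m)%:R :> R.
Proof. by rewrite natrM mulrNN mulrA mul1r mulVf ?mul1r // pnatr_eq0. Qed.

Lemma neg_double_neq0 (R : numFieldType) (m : nat) :
  (- (2 * m)%:R != 0 :> R) = (0 < m)%N.
Proof. by rewrite oppr_eq0 pnatr_eq0 muln_eq0 /= lt0n. Qed.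

Local Close Scope ring_scope.

(** * The theorem *)

Lemma least_some (P : pred nat) (n : nat) :
  least P = Some n <-> P n /\ forall m, m < n -> ~~ P m.
Proof.
rewrite /least; case: pselect => [exP | noP]; last first.
  by split=> // -[Pn _]; case: noP; exists n.
case: ex_minnP => k Pk k_min; split=> [[<-] | [Pn n_min]].
  by split=> // m; apply: contraTN => /k_min; rewrite -leqNgt.
congr Some; apply/eqP; rewrite eqn_leq k_min //=.
by rewrite leqNgt; apply: contraTN Pk => /n_min.
Qed.

(** Two predicates need only agree as far as the first one has not been met:
    [charcoef] and [gamma] are known up to the girth and no further. *)
Lemma eq_least (P Q : pred nat) :
  (forall n, (forall m, m < n -> ~~ P m) -> P n = Q n) -> least P = least Q.
Proof.
move=> PQ; case lP: (least P) => [n | ].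
  have [Pn n_min] := (least_some _ _).1 lP; apply/esym/least_some.
  split=> [ | m mn]; first by rewrite -PQ.
  by rewrite -PQ ?n_min // => l lm; rewrite n_min // (ltn_trans lm).
case lQ: (least Q) => [n | //]; have [Qn _] := (least_some _ _).1 lQ.
have noP m : ~~ P m.
  apply/negP => Pm.
  suff [l lE] : exists l, least P = Some l by rewrite lE in lP.
  by rewrite /least; case: pselect => [exP | []]; [eexists | exists m].
by move: (noP n); rewrite PQ ?Qn.
Qed.

Theorem theorem6p3 (R : numFieldType) (T : finType) (H : hypergraph T)
    (simpleH : simple_hypergraph H) :
  (oegr H
     = least (fun i => [&& odd i, 1 <= i <= e_index H & charcoef R H i != 0%R])
   /\ forall d : nat, oegr H = Some d ->
        ((num_exact_cycles H d)%:R = - (1 / 2) * charcoef R H d :> R)%R)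
  /\
  (egr H = least (fun i => (1 <= i <= e_index H) && (gamma R H i != 0%R))
   /\ forall t : nat, egr H = Some t ->
        ((num_exact_cycles H t)%:R = - (1 / 2) * gamma R H t :> R)%R).
Proof.
split; split.
- apply: eq_least => n short; case: (boolP (odd n)) => //= odd_n.
  rewrite odd_gt0 //=; case: leqP => [nk | kn] /=; last first.
    by apply: contraTF kn => /exact_cycles_le_index; rewrite -leqNgt.
  rewrite charcoef_first_odd // ?neg_double_neq0 ?exact_cycles_neq0 //.
  by move=> m /short; case: odd => //=; rewrite negbK => /eqP.
- move=> d /least_some[/andP[odd_d d_cyc] short].
  rewrite charcoef_first_odd //; first exact: half_neg_double.
    exact: exact_cycles_le_index.
  by move=> m /short; case: odd => //=; rewrite negbK => /eqP.
- apply: eq_least => n short; case: n short => [ | n] short /=.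
    (* The index 0 is excluded on the right, and no cycle has length 0. *)
    rewrite exact_cycles_neq0 num_exact_cyclesE card_gt0; apply/set0Pn.
    by case=> B /imsetP[s /cyclic_permsP[]].
  case: ltnP => [nk | kn]; last first.
    by apply: contraTF kn => /exact_cycles_le_index; rewrite -ltnNge.
  rewrite gamma_first // ?neg_double_neq0 ?exact_cycles_neq0 //.
  by move=> m /short; rewrite negbK => /eqP.
move=> t /least_some[t_cyc short]; rewrite gamma_first //.
- exact: half_neg_double.
- exact: exact_cycles_le_index.
by move=> m /short; rewrite negbK => /eqP.
Qed.
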